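(* For every prime number $p\ge 2$ there are infinitely many (pairwise non-isomorphic) finite $p$-groups that admit an unmixed Beauville structure.
   Context: An (unmixed) Beauville structure on a finite group $G$ consists of an ordered pair of triples $(x,y,z)$ and $(a,b,c)$ of elements of $G$ such that (1) $xyz=1=abc$; (2) $G$ is generated by $\{x,y,z\}$ and also by $\{a,b,c\}$; (3) no non-trivial power (i.e. power different from $1$) of an element of $\{x,y,z\}$ is conjugate in $G$ to a power of an element of $\{a,b,c\}$. *)

(* Defs.v *)
From HB Require Import structures.
From mathcomp Require Import all_boot all_order all_fingroup all_solvable.

Set Implicit Arguments.
Unset Strict Implicit.
Unset Printing Implicit Defensive.

Local Open Scope group_scope.

(* Exponents range over nat: in a finite group every integer power of an
   element is a natural power of it. *)
Definition beauville_structure (gT : finGroupType) (G : {group gT})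
    (x y z a b c : gT) : Prop :=
  [/\ [set x; y; z] \subset G /\ [set a; b; c] \subset G,
      x * y * z = 1 /\ a * b * c = 1,
      <<[set x; y; z]>> = G /\ <<[set a; b; c]>> = G
    & forall u v : gT, u \in [set x; y; z] -> v \in [set a; b; c] ->
      forall m n : nat, u ^+ m != 1 -> v ^+ n \notin (u ^+ m) ^: G].

Definition admits_beauville_structure (gT : finGroupType) (G : {group gT})
    : Prop :=
  exists x y z a b c : gT, beauville_structure G x y z a b c.

(* Main.v *)
(* Let W be the wreath product of Z/q by Z/q, q = p^(k+3), let s generate the
   top group, let e = [s, d^-1] for a coordinate vector d of the base, and let
   t = (es)^-1, which is conjugate to s^-1. In W^3 put x = (e, t, s),
   y = (s, e, t), z = (t, s, e), let G = <x, y, z>, and let the second triple be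
     a = [y, x^-1] x [z, y^-1]^-1, b = [z, y^-1] y [x, z^-1]^-1,
     c = [x, z^-1] z [y, x^-1]^-1.
   It agrees with the first one modulo the Frattini subgroup, so it generates
   G. To separate a power of x, y or z from the powers of a, b, c, look at the
   coordinate where it is a power of e: there a, b, c are, in some order, s, a
   conjugate of s^-1, and the base element e^s e^(s^-1) e^-1. Nontrivial powers
   of s lie outside the base group, and a nontrivial power of the last element
   is never a power of a shift of e. *)

Require Import Defs.
From HB Require Import structures.
From mathcomp Require Import all_boot all_order all_fingroup all_solvable.
From mathcomp Require Import all_algebra ring.

Set Implicit Arguments.
Unset Strict Implicit.
Unset Printing Implicit Defensive.

Import GRing.Theory.

Local Open Scope group_scope.

(* The commutators telescope in the product of the twists of the
   three rotations of a triple. *)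
Definition twist (gT : finGroupType) (x y z : gT) : gT :=
  [~ y, x^-1] * x * [~ z, y^-1]^-1.

(** * Twisting a generating triple of a p-group *)

Section Twist.

Variables (gT : finGroupType) (x y z : gT).
Hypothesis xyz1 : x * y * z = 1.

Lemma twist_prod : twist x y z * twist y z x * twist z x y = 1.
Proof.
transitivity ([~ y, x^-1] * (x * y * z) * [~ y, x^-1]^-1).
  rewrite /twist; move: [~ y, x^-1] [~ z, y^-1] [~ x, z^-1] => u v w.
  by rewrite !mulgA !mulgKV.
by rewrite xyz1 mulg1 mulgV.
Qed.

(** Commutators lie in the Frattini subgroup, so the twists are congruent to [x], [y], [z] modulo
    it, and its elements are non-generators. *)
Lemma gen_twist (p : nat) (G : {group gT}) :
    p.-group G -> <<[set x; y; z]>> = G ->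
  <<[set twist x y z; twist y z x; twist z x y]>> = G.
Proof.
move=> pG genG.
have [xG yG zG] : [/\ x \in G, y \in G & z \in G].
  by rewrite -genG; split; apply: mem_gen; rewrite !inE eqxx ?orbT.
have commPhi u v : u \in G -> v \in G -> [~ u, v] \in 'Phi(G).
  move=> uG vG; rewrite (Phi_joing pG); apply: (subsetP (joing_subl _ _)).
  exact: mem_commg.
have memG u v w : u \in G -> v \in G -> w \in G -> twist u v w \in G.
  by move=> uG vG wG; rewrite /twist !(groupM, groupV, groupR).
apply: Phi_nongen; apply/eqP; rewrite eqEsubset; apply/andP; split.
  rewrite join_subG Phi_sub; apply/subsetP => u.
  by rewrite !inE => /orP[/orP[]|] /eqP ->; apply: memG.
rewrite -{1}genG gen_subG; apply/subsetP => u.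
set H := (X in _ -> _ \in X).
have PhiH v : v \in 'Phi(G) -> v \in H.
  by apply: (subsetP (joing_subl _ _)).
have twistH v : v \in [set twist x y z; twist y z x; twist z x y] -> v \in H.
  by move=> vT; apply: (subsetP (joing_subr _ _)).
have untwist v w r : v \in G -> w \in G -> r \in G -> twist v w r \in H ->
    v \in H.
  move=> vG wG rG; rewrite /twist groupMr; last first.
    by rewrite groupV PhiH // commPhi ?groupV.
  by rewrite groupMl // PhiH // commPhi ?groupV.
by rewrite !inE => /orP[/orP[]|] /eqP ->;
  [apply: untwist xG yG zG _ | apply: untwist yG zG xG _
  | apply: untwist zG xG yG _]; apply: twistH; rewrite !inE eqxx ?orbT.
Qed.

End Twist.

(** The conjugator ranges over the whole type, so the coordinates of any element of [tripling] can
    be used. *)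
Definition powers_nonconj (gT : finGroupType) (u v : gT) : Prop :=
  forall m n g, u ^+ m != 1 -> v ^+ n != (u ^+ m) ^ g.

(** * The subgroup of [W * W * W] generated by rotated triples *)

Section Tripling.

Variables (p : nat) (W : finGroupType) (e s t : W).
Hypotheses (pW : p.-nat #|W|) (est1 : e * s * t = 1).
Hypothesis ord_e : forall m, e ^+ m = 1 -> s ^+ m = 1 /\ t ^+ m = 1.
Hypothesis nconj_e : forall v,
  v \in [:: twist e s t; twist s t e; twist t e s] -> powers_nonconj e v.

Let x : W * W * W := (e, t, s).
Let y : W * W * W := (s, e, t).
Let z : W * W * W := (t, s, e).

Definition tripling : {group W * W * W} := <<[set x; y; z]>>%G.

Lemma tripling_pgroup : p.-group tripling.
Proof.
apply: (pgroupS (subsetT _)); rewrite /pgroup cardsT !card_prod.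
by rewrite !pnatM pW.
Qed.

(** Makes the orders unbounded along the family of groups. *)
Lemma order_tripling : #[e] <= #|tripling|.
Proof.
have xT : x \in tripling by rewrite mem_gen // !inE eqxx.
have XE m : x ^+ m = (e ^+ m, t ^+ m, s ^+ m).
  by elim: m => // m IHm; rewrite !expgS IHm.
have sxT : <[x]> \subset tripling by rewrite cycle_subG.
apply: leq_trans (subset_leq_card sxT); apply: dvdn_leq => //.
rewrite order_dvdn.
by have := expg_order x; rewrite XE => -[/eqP].
Qed.

Lemma tripling_beauville : admits_beauville_structure tripling.
Proof.
have ste : s * t * e = 1.
  by apply: (mulgI e); rewrite mulg1 !mulgA est1 mul1g.
have tes : t * e * s = 1.
  by apply: (mulgI s); rewrite mulg1 !mulgA ste mul1g.
have xyz : x * y * z = 1.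
  have -> : x * y * z = (e * s * t, t * e * s, s * t * e) by [].
  by rewrite est1 tes ste.
have XE (u : W * W * W) m : u ^+ m = (u.1.1 ^+ m, u.1.2 ^+ m, u.2 ^+ m).
  by elim: m => [|m IHm] //; rewrite !expgS IHm; case: u {IHm} => -[].
exists x, y, z, (twist x y z), (twist y z x), (twist z x y).
have genT : <<[set twist x y z; twist y z x; twist z x y]>> = tripling.
  exact: gen_twist tripling_pgroup _.
split.
- by split; [rewrite subset_gen | rewrite -genT subset_gen].
- by split; [| apply: twist_prod].
- by [].
move=> u v uT vT m n um1; apply/imsetP => -[g _ vn_um].
pose T := [:: twist e s t; twist s t e; twist t e s].
(* In each coordinate [x], [y], [z] form a rotation of [e], [s], [t], and [T] is closed under such
   rotations. *)
have /and3P[v1 v2 v3] : [&& v.1.1 \in T, v.1.2 \in T & v.2 \in T].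
  move: vT; rewrite !inE => /orP[/orP[]|] /eqP ->;
  by rewrite /= !eqxx ?orbT.
(* By [ord_e], if the [e] coordinate of a power of [u] dies, so do the other two. *)
have ndeg : e ^+ m != 1.
  apply: contraNneq um1 => em1; have [sm1 tm1] := ord_e em1.
  move: uT; rewrite !inE => /orP[/orP[]|] /eqP ->;
  by rewrite XE /= em1 sm1 tm1.
move: vn_um; rewrite !XE => vn_um.
have [E1 E2 E3] : [/\ v.1.1 ^+ n = (u.1.1 ^+ m) ^ g.1.1,
    v.1.2 ^+ n = (u.1.2 ^+ m) ^ g.1.2 & v.2 ^+ n = (u.2 ^+ m) ^ g.2].
  by case: vn_um => -> -> ->.
move: uT; rewrite !inE => /orP[/orP[]|] /eqP ux; subst u.
- by have := nconj_e v1 n g.1.1 ndeg; rewrite E1 eqxx.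
- by have := nconj_e v2 n g.1.2 ndeg; rewrite E2 eqxx.
- by have := nconj_e v3 n g.2 ndeg; rewrite E3 eqxx.
Qed.

End Tripling.

Ltac cancel_words :=
  rewrite !invMg !invgK !mulgA !(mulgK, mulgKV, mulVg, mulgV, mul1g).

(** * Twists of e, s and (es)^-1 as explicit words *)

Section TwistValues.

Variables (W : finGroupType) (e s : W).
Let t := (e * s)^-1.

Lemma twist_est : twist e s t = e ^ s * e ^ s^-1 * e^-1.
Proof. by rewrite /twist /t /commg /conjg; cancel_words. Qed.

Hypothesis ce : commute e (e ^ s).

(** Commutation reduces the factor e^-1 (e^s)^-1 e to (e^s)^-1, and e s (e^s)^-1 = s. *)
Lemma twist_ste : twist s t e = s.
Proof.
transitivity (e * s * (e^-1 * (e ^ s)^-1 * e)).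
  by rewrite /twist /t /commg /conjg; cancel_words.
by rewrite -invMg -ce /conjg; cancel_words.
Qed.

Lemma twist_tes : twist t e s = t ^ (e ^ s * e^-1)^-1.
Proof.
transitivity (e^-1 * e ^ s * t * (e ^ s * e^-1)^-1).
  by rewrite /twist /t /commg /conjg; cancel_words.
have -> : e^-1 * e ^ s = e ^ s * e^-1.
  by apply: (mulgI e); rewrite mulgA mulgV mul1g mulgA ce mulgK.
by rewrite [RHS]/conjg invgK mulgA.
Qed.

End TwistValues.

(** * Reduction of non-conjugacy to two base cases *)

Section NonConjugacy.

Variables (W : finGroupType) (d s : W).
Let e := d ^ s * d^-1.
Let t := (e * s)^-1.
Hypothesis ce : commute e (e ^ s).
Hypothesis nconj_s : powers_nonconj e s.
Hypothesis nconj_es : powers_nonconj e (e ^ s * e ^ s^-1 * e^-1).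

(** Since d^-1 s = s (d^s)^-1, the product es = d^s d^-1 s is a conjugate of s. *)
Lemma thirdE : t = (s ^ (d ^ s)^-1)^-1.
Proof. by rewrite /t /e /conjg; cancel_words. Qed.

Lemma powers_nonconj_third : powers_nonconj e t.
Proof.
move=> m n g em1; apply/eqP => tn.
(* As [t] is conjugate to the inverse of [s], the power of [e] is inverted and rewritten with a
   natural exponent. *)
have /cycleP[k ek] : (e ^+ m)^-1 \in <[e]> by rewrite groupV mem_cycle.
have ek1 : e ^+ k != 1 by rewrite -ek invg_eq1.
have /eqP[] := nconj_s n (g * d ^ s) ek1.
rewrite conjgM -ek conjVg -tn -expVgn.
by rewrite thirdE !(invgK, expVgn, conjXg, conjgK, conjgKV).
Qed.

Lemma powers_nonconj_twists v :
  v \in [:: twist e s t; twist s t e; twist t e s] ->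
  powers_nonconj e v.
Proof.
rewrite !inE => /or3P[] /eqP -> m n g em1.
- by rewrite twist_est nconj_es.
- by rewrite twist_ste // nconj_s.
rewrite twist_tes //; apply/eqP => tn.
have /eqP[] := powers_nonconj_third n (g * (e ^ s * e^-1)) em1.
by rewrite [RHS]conjgM -tn -conjXg conjgKV.
Qed.

End NonConjugacy.

(** * The wreath product of Z/q by Z/q *)

Record wreath (q : nat) : Type := Wreath {
  wbase : {ffun 'Z_q -> 'Z_q};
  wtop : 'Z_q
}.

Section Wreath.

Variable q : nat.

Definition wreath_pair (g : wreath q) := (wbase g, wtop g).
Definition pair_wreath (u : {ffun 'Z_q -> 'Z_q} * 'Z_q) := Wreath u.1 u.2.
Lemma wreath_pairK : cancel wreath_pair pair_wreath.
Proof. by case. Qed.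

Lemma pair_wreathK : cancel pair_wreath wreath_pair.
Proof. by case. Qed.

HB.instance Definition _ := Finite.copy (wreath q) (can_type wreath_pairK).

(** [Wreath v j] stands for [wrot ^+ j * wtrans v]; moving the top of [h] left past the base of [g]
    shifts that base. *)
Definition wreath_mul (g h : wreath q) : wreath q :=
  Wreath [ffun i => (wbase g (i + wtop h) + wbase h i)%R] (wtop g + wtop h)%R.
Definition wreath_one : wreath q := Wreath 0%R 0%R.
Definition wreath_inv (g : wreath q) : wreath q :=
  Wreath [ffun i => (- wbase g (i - wtop g))%R] (- wtop g)%R.

Lemma wreath_mulA : associative wreath_mul.
Proof.
move=> g h k; congr Wreath; last exact: addrA.
by apply/ffunP => i; rewrite !ffunE /= (addrC (wtop h)) !addrA.
Qed.

Lemma wreath_mul1 : left_id wreath_one wreath_mul.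
Proof.
case=> v j; congr Wreath; last exact: add0r.
by apply/ffunP => i; rewrite !ffunE add0r.
Qed.

Lemma wreath_mulV : left_inverse wreath_one wreath_inv wreath_mul.
Proof.
case=> v j; congr Wreath; last exact: addNr.
by apply/ffunP => i; rewrite !ffunE addrK addNr.
Qed.

HB.instance Definition _ :=
  Finite_isGroup.Build (wreath q) wreath_mulA wreath_mul1 wreath_mulV.

(** For q at most 1, ['Z_q] is Z/2 by convention. *)
Lemma card_wreath : 1 < q -> #|{: wreath q}| = (q ^ q * q)%N.
Proof.
move=> q1; rewrite (bij_eq_card (Bijective wreath_pairK pair_wreathK)).
by rewrite card_prod card_ffun !card_ord Zp_cast.
Qed.

Definition wtrans (v : {ffun 'Z_q -> 'Z_q}) : wreath q := Wreath v 0%R.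
Definition wrot : wreath q := Wreath 0%R 1%R.

Lemma wtransM v w : wtrans v * wtrans w = wtrans (v + w)%R.
Proof.
congr Wreath; last exact: addr0.
by apply/ffunP => i; rewrite !ffunE addr0.
Qed.

Lemma wtransX v m : wtrans v ^+ m = wtrans (v *+ m)%R.
Proof. by elim: m => [|m IHm] //; rewrite expgS IHm wtransM mulrS. Qed.

Lemma wtransV v : (wtrans v)^-1 = wtrans (- v)%R.
Proof. by apply/eqP; rewrite eq_invg_mul wtransM subrr. Qed.

Lemma wtrans_inj : injective wtrans.
Proof. by move=> v w []. Qed.

Lemma wtransJ v g : wtrans v ^ g = wtrans [ffun i => v (i + wtop g)%R].
Proof.
apply: (mulgI g); rewrite -conjgC; case: g => w j.
congr Wreath; last by rewrite /= addr0 add0r.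
by apply/ffunP => i; rewrite !ffunE addr0 addrC.
Qed.

Lemma wrotX m : wrot ^+ m = Wreath 0%R m%:R%R.
Proof.
elim: m => // m IHm; rewrite expgS IHm; congr Wreath; last by rewrite mulrS.
by apply/ffunP => i; rewrite !ffunE addr0.
Qed.

Definition wdelta := wtrans [ffun i => (i == 0%R)%:R%R].
Definition wdiff := wdelta ^ wrot * wdelta^-1.

Definition wdiff_fun : {ffun 'Z_q -> 'Z_q} :=
  [ffun i => ((i == - 1)%:R - (i == 0)%:R)%R].
Lemma wdiffE : wdiff = wtrans wdiff_fun.
Proof.
rewrite /wdiff /wdelta wtransJ wtransV wtransM; congr wtrans.
by apply/ffunP => i; rewrite !ffunE addr_eq0.
Qed.

Hypothesis q5 : 4 < q.
Let q1 : 1 < q. Proof. exact: leq_trans q5. Qed.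

Lemma Zq_eq0 m : ((m%:R : 'Z_q) == 0)%R = (q %| m).
Proof. by rewrite -val_eqE /= val_Zp_nat. Qed.

Lemma small_neq0 m : 0 < m < 5 -> ((m%:R : 'Z_q) == 0)%R = false.
Proof.
case/andP=> m0 m5; rewrite Zq_eq0; apply/negbTE/negP => /(dvdn_leq m0).
by rewrite leqNgt (leq_trans _ q5).
Qed.

Lemma wdiff_funE i : wdiff_fun i = ((i + 1 == 0)%:R - (i == 0)%:R)%R.
Proof. by rewrite ffunE addr_eq0. Qed.

Lemma wdiff_fun0 : wdiff_fun 0%R = (-1)%R.
Proof. by rewrite wdiff_funE eqxx add0r. Qed.

Lemma wdiff_funN1 : wdiff_fun (-1)%R = 1%R.
Proof. by rewrite wdiff_funE addNr eqxx oppr_eq0 oner_eq0 subr0. Qed.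

Lemma wdiff_fun_nat m : 0 < m < 4 -> wdiff_fun m%:R%R = 0%R.
Proof.
case/andP=> m0 m4; rewrite wdiff_funE natr1.
rewrite (@small_neq0 m.+1) // (@small_neq0 m).
  by rewrite subrr.
by rewrite m0 ltnW.
Qed.

Lemma wdiff_funN_nat m : 1 < m < 5 -> wdiff_fun (- m%:R)%R = 0%R.
Proof.
case: m => // m /andP[m0 m5]; rewrite wdiff_funE.
rewrite -natr1 opprD addrNK -opprD !oppr_eq0.
rewrite natr1 (@small_neq0 m.+1) // (@small_neq0 m) ?subrr //.
by rewrite -ltnS m0 ltnW.
Qed.

Lemma wdiffX_eq1 m : (wdiff ^+ m == 1) = (q %| m).
Proof.
rewrite wdiffE wtransX (inj_eq wtrans_inj (wdiff_fun *+ m)%R 0%R) -Zq_eq0.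
(* At 0 the base function is -1, a unit. *)
apply/eqP/eqP=> [/ffunP/(_ 0%R)|m0].
  rewrite ffunMnE !ffunE eqxx eq_sym oppr_eq0 oner_eq0.
  by rewrite sub0r mulNrn => /eqP; rewrite oppr_eq0 => /eqP.
by apply/ffunP => i; rewrite ffunMnE -[LHS]mulr_natr m0 mulr0 ffunE.
Qed.

Lemma wrotX_eq1 m : (wrot ^+ m == 1) = (q %| m).
Proof.
by rewrite wrotX -Zq_eq0; apply/eqP/eqP => [[]|->].
Qed.

Lemma order_wdiff : #[wdiff] = q.
Proof.
apply/eqP; rewrite eqn_dvd order_dvdn wdiffX_eq1 dvdnn.
by rewrite -wdiffX_eq1 expg_order /=.
Qed.

Lemma nonconj_wrot : powers_nonconj wdiff wrot.
Proof.
move=> m n g m1; apply/eqP => E; case/eqP: (m1).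
apply: (conjg_inj g); rewrite conj1g -E.
apply/eqP; rewrite wrotX_eq1 -Zq_eq0.
have /(congr1 (@wtop q)) := E.
by rewrite wrotX wdiffE wtransX wtransJ /= => ->.
Qed.

Lemma wdiff_twistE : wdiff ^ wrot * wdiff ^ wrot^-1 * wdiff^-1 =
  wtrans [ffun i => (wdiff_fun (i + 1) + wdiff_fun (i - 1) - wdiff_fun i)%R].
Proof.
rewrite wdiffE !wtransJ wtransV !wtransM; congr wtrans.
by apply/ffunP => i; rewrite !ffunE.
Qed.

(* On [:: -2; -1; 0; 1] the base function of the twist takes the values
   [:: 1; -2; 2; -1], while a conjugate of a power of [wdiff] is supported on
   two cyclically adjacent points; since q > 4, it vanishes at -2 or at 1. *)
Lemma nonconj_wdiff_twist :
  powers_nonconj wdiff (wdiff ^ wrot * wdiff ^ wrot^-1 * wdiff^-1).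
Proof.
move=> m n g m1; apply/eqP => E; case/negP: m1.
rewrite wdiffX_eq1 -Zq_eq0; move: E.
rewrite wdiff_twistE wdiffE !wtransX wtransJ => /wtrans_inj/ffunP E.
have {}E i : ((wdiff_fun (i + 1) + wdiff_fun (i - 1) - wdiff_fun i) * n%:R
                = wdiff_fun (i + wtop g) * m%:R :> 'Z_q)%R.
  have := E i; rewrite ffunMnE [X in (X *+ n)%R]ffunE [RHS]ffunE ffunMnE.
  by rewrite !mulr_natr.
have n0 : (n%:R = 0 :> 'Z_q)%R.
  have [c0|c0] := eqVneq (wdiff_fun (1 + wtop g)%R) 0%R.
    have /eqP := E 1%R; rewrite c0 mul0r subrr wdiff_fun0.
    rewrite (wdiff_fun_nat (m := 2)) // (wdiff_fun_nat (m := 1)) //.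
    by rewrite add0r subr0 mulN1r oppr_eq0 => /eqP.
  have := E (- 2%:R)%R.
  have -> : (- 2%:R + 1 = -1 :> 'Z_q)%R by rewrite (natrD _ 1 1) opprD addrNK.
  have -> : (- 2%:R - 1 = - 3%:R :> 'Z_q)%R by rewrite -opprD natr1.
  rewrite wdiff_funN1 (wdiff_funN_nat (m := 3)) // (wdiff_funN_nat (m := 2)) //.
  rewrite addr0 subr0 mul1r => ->.
  suff -> : wdiff_fun (- 2%:R + wtop g)%R = 0%R by rewrite mul0r.
  (* Nonvanishing at [1 + wtop g] puts this point at -1 or 0, hence [-2 + wtop g] at -4 or -3,
     outside the support. *)
  move: c0; rewrite wdiff_funE.
  have [c2 _|_] := eqVneq (1 + wtop g + 1)%R 0%R; last first.
  have [c1 _|_] := eqVneq (1 + wtop g)%R 0%R; last by rewrite subrr eqxx.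
    have -> : (- 2%:R + wtop g = 1 + wtop g - 3%:R)%R by ring.
    by rewrite c1 sub0r wdiff_funN_nat.
  have -> : (- 2%:R + wtop g = 1 + wtop g + 1 - 4%:R)%R by ring.
  by rewrite c2 sub0r wdiff_funN_nat.
(* Now the left side vanishes, while here the right side is -m. *)
have /esym/eqP := E (- wtop g)%R; rewrite n0 mulr0 addNr wdiff_fun0.
by rewrite mulN1r oppr_eq0.
Qed.

End Wreath.

(** * The infinite family *)

Theorem corollary3 (p : nat) (hp : prime p) :
  exists (gT : nat -> finGroupType) (G : forall i : nat, {group gT i}),
    (forall i : nat, p.-group (G i) /\ admits_beauville_structure (G i)) /\
    (forall i j : nat, i <> j -> ~~ (G i \isog G j)).
Proof.
(* Exponent at least 3 gives q > 4 even for p = 2. *)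
pose q k := (p ^ k.+3)%N.
have q5 k : 4 < q k.
  apply: (@leq_trans (2 ^ 3)) => //; apply: (@leq_trans (p ^ 3)).
    by rewrite leq_exp2r ?prime_gt1.
  by rewrite leq_exp2l ?prime_gt1.
pose H k := tripling (wdiff (q k)) (wrot (q k)) (wdiff (q k) * wrot (q k))^-1.
have ord_e k m : wdiff (q k) ^+ m = 1 -> wrot (q k) ^+ m = 1 /\
     ((wdiff (q k) * wrot (q k))^-1) ^+ m = 1.
  move/eqP; rewrite (wdiffX_eq1 (q5 k)) -(wrotX_eq1 (q5 k)) => /eqP E.
  by rewrite (thirdE (wdelta _)) expVgn -conjXg E conj1g invg1.
have pW k : p.-nat #|{: wreath (q k)}|.
  by rewrite card_wreath ?(ltn_trans _ (q5 k)) // pnatM !pnatX pnat_id.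
have ce k : commute (wdiff (q k)) (wdiff (q k) ^ wrot (q k)).
  by rewrite wdiffE wtransJ /commute !wtransM addrC.
have beauH k : admits_beauville_structure (H k).
  apply: (tripling_beauville (pW k)) (ord_e k) _; first by rewrite mulgV.
  exact: (powers_nonconj_twists (ce k) (@nonconj_wrot _ (q5 k))
    (@nonconj_wdiff_twist _ (q5 k))).
have leH k : k <= #|H k|.
  apply: leq_trans (order_tripling _ _ _).
  rewrite order_wdiff //; apply: ltnW.
  apply: leq_trans (ltn_expl _ (prime_gt1 hp)) _.
  by rewrite leq_exp2l ?prime_gt1 // !leqW.
(* Each index exceeds the order of the previous group, so by [leH] the orders strictly increase. *)
pose e i := iter i (fun k => #|H k|.+1) 0.
exists (fun i => wreath (q (e i)) * wreath (q (e i)) * wreath (q (e i)))%type.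
exists (fun i => H (e i)); split=> [i|i j ij].
  by split; [apply: tripling_pgroup (pW _) | apply: beauH].
have ltH : {homo (fun i => #|H (e i)|) : i j / i < j}.
  by apply: homo_ltn => [? ? ?|k]; [exact: ltn_trans | exact: leH].
apply/negP => /card_isog E.
by case: (ltngtP i j) => // /ltH; rewrite /= E ltnn.
Qed.
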